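(* Let $n\ge 2$, $m=2$. Let $0<\underline a\le\bar a<\infty$, $d^0\in\mathbb{R}^n$ with $d_i^0\in[\underline a,\bar a]$ for all $i\in[n]$, $\alpha>0$, $\bar d_i=\alpha d_i^0$ for $i\in[n]$, $0\le\Gamma\le n$ (real), and $$U=\left\{d\in\mathbb{R}^n:\ d_i=d_i^0+\bar d_iu_i,\ u_i\in[0,1]\ (i\in[n]),\ \sum_{i=1}^nu_i\le\Gamma\right\}.$$ Let $\tilde x\in\{0,1\}^n$ be a partition of the tasks to the two machines which minimizes the makespan $\max\{x^\top d^0,(e-x)^\top d^0\}$ of the deterministic problem with $d=d^0$, and let $\mathcal{I}=\{i:\tilde x_i=1\}$ and $\bar{\mathcal{I}}=[n]\setminus\mathcal{I}$ be the sets of tasks that $\tilde x$ allocates to the first and the second machine, respectively. For $\mathcal{S}\in\{\mathcal{I},\bar{\mathcal{I}}\}$ let $d^{0,\mathcal{S}}_{(1)}\ge\dots\ge d^{0,\mathcal{S}}_{(|\mathcal{S}|)}$ be the values $d_i^0$, $i\in\mathcal{S}$, in nonincreasing order, and let $\Delta^{\mathcal{S}}(\Gamma)=\min\{\Gamma,|\mathcal{S}|\}-\min\{\lfloor\Gamma\rfloor,|\mathcal{S}|\}$. Then $$\frac{\mathrm{SA}}{\mathrm{PH}}\ \le\ \frac{n}{n+\Gamma\alpha}\left(1+\alpha\max_{\mathcal{S}\in\{\mathcal{I},\bar{\mathcal{I}}\}}\frac{\sum_{k=1}^{\min\{|\mathcal{S}|,\lfloor\Gamma\rfloor\}}d^{0,\mathcal{S}}_{(k)}+\Delta^{\mathcal{S}}(\Gamma)\,d^{0,\mathcal{S}}_{(\min\{|\mathcal{S}|,\lfloor\Gamma\rfloor\}+1)}}{\sum_{i\in\mathcal{S}}d_i^0}\right),$$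 where $$\mathrm{SA}=\min_{x\in\{0,1\}^n}\ \sup_{d\in U}\ \max\{x^\top d,(e-x)^\top d\},\qquad \mathrm{PH}=\sup_{d\in U}\ \min_{x\in\{0,1\}^n}\ \max\{x^\top d,(e-x)^\top d\}.$$
   Context: Notation: $[n]=\{1,\dots,n\}$ and $e\in\mathbb{R}^n$ is the all-ones vector. There are $n$ tasks to be processed on $m=2$ identical machines, with uncertain task durations $d=(d_1,\dots,d_n)\in U$ (a budgeted uncertainty set with nominal durations $d^0$, maximal perturbations $\bar d$ and budget $\Gamma$). An allocation of tasks to the two machines is a vector $x\in\{0,1\}^n$ with $x_i=1$ if task $i$ is on machine 1 and $x_i=0$ if it is on machine 2; the makespan of $x$ under durations $d$ is $\max\{x^\top d,(e-x)^\top d\}$. SA is the worst-case makespan of the optimal static allocation policy (allocation fixed before $d$ is known), and PH is the worst-case makespan of the perfect hindsight policy (allocation chosen optimally knowing $d$). Convention: when $\min\{|\mathcal{S}|,\lfloor\Gamma\rfloor\}+1>|\mathcal{S}|$, one has $\Delta^{\mathcal{S}}(\Gamma)=0$ and the term $\Delta^{\mathcal{S}}(\Gamma)\,d^{0,\mathcal{S}}_{(\cdot)}$ is read as $0$. *)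

(* Defs.v *)
From HB Require Import structures.
From mathcomp Require Import all_boot all_order all_algebra.
From mathcomp Require Import boolp classical_sets reals.
Set Implicit Arguments.
Unset Strict Implicit.
Unset Printing Implicit Defensive.
Import Order.TTheory GRing.Theory Num.Theory.
Local Open Scope classical_set_scope.
Local Open Scope ring_scope.

(* [x i = true] puts task [i] on the first machine, [x i = false] on the
   second one. *)
Definition allocation (n : nat) := {ffun 'I_n -> bool}.

(* max {x^T d, (e - x)^T d} *)
Definition makespan (R : realType) (n : nat) (x : allocation n)
    (d : 'rV[R]_n) : R :=
  Num.max (\sum_(i < n) (x i)%:R * d 0 i)
          (\sum_(i < n) (1 - (x i)%:R) * d 0 i).

(* Minimum of [f] over the finite nonempty set of allocations; the constant
   allocation only witnesses nonemptiness. *)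
Definition min_alloc (R : realType) (n : nat) (f : allocation n -> R) : R :=
  f [arg min_(x < ([ffun=> false] : allocation n)) f x]%O.

Definition budgeted_set (R : realType) (n : nat) (d0 dbar : 'rV[R]_n)
    (Gamma : R) : set 'rV[R]_n :=
  [set d | exists u : 'rV[R]_n,
    [/\ forall i, d 0 i = d0 0 i + dbar 0 i * u 0 i,
        forall i, 0 <= u 0 i <= 1
      & \sum_(i < n) u 0 i <= Gamma]].

(* [sup] is the real supremum, meaningful for nonempty bounded sets [U], such as
   [budgeted_set d0 dbar Gamma] with [0 <= Gamma]. *)
Definition SA (R : realType) (n : nat) (U : set 'rV[R]_n) : R :=
  min_alloc (fun x : allocation n => sup [set makespan x d | d in U]).

Definition PH (R : realType) (n : nat) (U : set 'rV[R]_n) : R :=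
  sup [set min_alloc (fun x : allocation n => makespan x d) | d in U].

(* The k-th largest (k >= 1) of the values d0_i, i in S, counted with
   multiplicity; it is 0 when k > |S|. *)
Definition kth_largest (R : realType) (n : nat) (d0 : 'rV[R]_n)
    (S : {set 'I_n}) (k : nat) : R :=
  nth 0 (sort >=%R [seq d0 0 i | i <- enum S]) k.-1.

(* [Num.truncn Gamma] is the floor of [Gamma] since [0 <= Gamma]. *)
Definition Delta (R : realType) (n : nat) (S : {set 'I_n}) (Gamma : R) : R :=
  Num.min Gamma #|S|%:R - (minn (Num.truncn Gamma) #|S|)%:R.

Definition worst_ratio (R : realType) (n : nat) (d0 : 'rV[R]_n) (Gamma : R)
    (S : {set 'I_n}) : R :=
  let q := minn #|S| (Num.truncn Gamma) in
  (\sum_(1 <= k < q.+1) kth_largest d0 S k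
     + Delta S Gamma * kth_largest d0 S q.+1)
  / \sum_(i in S) d0 0 i.

(* Main.v *)
Require Import Defs.
From HB Require Import structures.
From mathcomp Require Import all_boot all_order all_algebra.
From mathcomp Require Import boolp classical_sets reals.
Set Implicit Arguments.
Unset Strict Implicit.
Unset Printing Implicit Defensive.
Import Order.TTheory GRing.Theory Num.Theory.
Local Open Scope ring_scope.

(** Let [M] be the makespan of [xt] under the nominal durations [d0], the least
one over all allocations.

Static side: fixing the allocation [xt] bounds [SA] from above.  The adversary
raises the load of a machine with task set [S] by [alpha] times at most the
value of a fractional knapsack problem with profits [d0 0 i], [i] in [S], unit
weights and capacity [Gamma].  That value is the greedy one, the sum of the
largest profits plus a fraction of the next one ([knapsack_le]), which is
[worst_ratio] times the nominal load of [S].  As both nominal loads are at most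
[M], the makespan stays below [M] times one plus [alpha] times the larger of the
two ratios ([makespan_le]).

Hindsight side: the adversary may spread the budget evenly, [Gamma / n] per task
([even_budget]).  Since [dbar] is proportional to [d0], this scales every
duration by [1 + alpha * Gamma / n], hence every makespan by the same factor
([makespanZ]), and [M * (1 + alpha * Gamma / n)] bounds [PH] from below.  The
quotient of the two bounds does not depend on [M]. *)

(** * Fractional knapsack *)

(** Entries before position [q] of a nonincreasing list lie above the entry at
[q], the later ones below, so the positive part keeps exactly the first [q].
For [q = size s] the threshold is the default value 0, which nonnegative
entries respect as well. *)
Lemma sum_excess_sorted (R : realDomainType) (s : seq R) (q : nat) :
  sorted >=%R s -> {in s, forall v, 0 <= v} -> (q <= size s)%N ->
  \sum_(v <- s) Num.max (v - s`_q) 0 = \sum_(0 <= k < q) (s`_k - s`_q).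
Proof.
move=> s_sorted s_ge0 le_qs.
have nth_ge0 k : 0 <= s`_k.
  by have [/(nth_default 0)->|/(mem_nth 0)/s_ge0] := leqP (size s) k.
have s_mono i j : (i <= j)%N -> s`_j <= s`_i.
  move=> le_ij; have [/(nth_default 0)->//|lt_js] := leqP (size s) j.
  have ge_trans : transitive (>=%R : rel R).
    by move=> y x z le_yx le_zy; exact: le_trans le_zy le_yx.
  apply: (sorted_leq_nth ge_trans lexx 0 s_sorted) => //.
  exact: leq_ltn_trans lt_js.
rewrite (big_nth 0) (big_cat_nat (leq0n q) le_qs) /=.
rewrite [X in _ + X]big1_seq ?addr0; last first.
  move=> k; rewrite mem_index_iota => /= /andP[le_qk _].
  by apply/max_idPr; rewrite subr_le0 s_mono.
rewrite big_nat [RHS]big_nat; apply: eq_bigr => k /= lt_kq; apply/max_idPl.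
by rewrite subr_ge0 s_mono // ltnW.
Qed.

(** This is linear programming duality.  Let [t] be the price of a unit of
budget, set at the first profit that the greedy solution does not fully
collect, or at 0 when it collects all of them.  Any [u] earns at most [t] times
its total weight, plus the excess over [t] of each profit above [t].  The total
weight is at most the smaller of [Gamma] and [#|S|], and the greedy solution
attains both terms. *)
Lemma knapsack_le (R : realType) (n : nat) (p u : 'rV[R]_n) (S : {set 'I_n})
    (Gamma : R) (q := minn #|S| (Num.truncn Gamma)) :
  (forall i, 0 <= p 0 i) -> (forall i, 0 <= u 0 i <= 1) ->
  \sum_(i < n) u 0 i <= Gamma ->
  \sum_(i in S) p 0 i * u 0 i <=
    \sum_(1 <= k < q.+1) kth_largest p S k
    + Delta S Gamma * kth_largest p S q.+1.
Proof.
move=> p_ge0 u01 u_le.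
set s := sort >=%R [seq p 0 i | i <- enum S].
pose t := s`_q.
have s_size : size s = #|S| by rewrite size_sort size_map -cardE.
have s_ge0 : {in s, forall v, 0 <= v}.
  by move=> v; rewrite mem_sort => /mapP[i _ ->].
have s_sorted : sorted >=%R s by apply: sort_sorted => x y; exact: le_total.
have t_ge0 : 0 <= t.
  rewrite /t; have [/(nth_default 0)->//|/(mem_nth 0)/s_ge0//] :=
    leqP (size s) q.
have weight_le : \sum_(i in S) u 0 i <= Num.min Gamma #|S|%:R.
  rewrite le_min; apply/andP; split.
    apply: le_trans u_le; rewrite [leRHS](bigID (mem S)) /= lerDl.
    by apply: sumr_ge0 => i _; case/andP: (u01 i).
  rewrite -sum1_card natr_sum; apply: ler_sum => i _.
  by case/andP: (u01 i).
have excess : \sum_(i in S) Num.max (p 0 i - t) 0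
              = \sum_(0 <= k < q) (s`_k - t).
  rewrite -sum_excess_sorted // ?s_size ?geq_minl // -/t.
  rewrite (perm_big [seq p 0 i | i <- enum S]) /=; last by rewrite perm_sort.
  by rewrite big_map big_enum.
have dual : \sum_(i in S) p 0 i * u 0 i <=
    \sum_(0 <= k < q) (s`_k - t) + t * Num.min Gamma #|S|%:R.
  rewrite -excess.
  apply: (@le_trans _ _ (\sum_(i in S) Num.max (p 0 i - t) 0
                         + t * \sum_(i in S) u 0 i)); last first.
    by rewrite lerD2l ler_wpM2l.
  rewrite mulr_sumr -big_split /=; apply: ler_sum => i _.
  rewrite -[X in X * _](subrK t) mulrDl lerD2r.
  have /andP[u_ge0 u_le1] := u01 i.
  apply: (@le_trans _ _ (Num.max (p 0 i - t) 0 * u 0 i)).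
    by rewrite ler_wpM2r // le_max lexx.
  by rewrite ler_piMr // le_max lexx orbT.
(* the dual bound and the greedy value agree: the price of the [q] fully
   collected profits cancels, leaving the fraction [Delta] of the next one *)
apply: le_trans dual _; rewrite le_eqVlt; apply/orP; left; apply/eqP.
rewrite big_add1 /= /kth_largest /= -/s -/t sumrB.
rewrite big_const_nat iter_addr_0 subn0 /Delta [minn (Num.truncn _) _]minnC -/q.
by rewrite mulrBl mulr_natl (mulrC t) -addrA (addrC (- _)).
Qed.

(** When the profits on [S] vanish, so does the denominator of [worst_ratio];
both sides are then 0. *)
Lemma perturbation_le (R : realType) (n : nat) (p u : 'rV[R]_n)
    (S : {set 'I_n}) (Gamma : R) :
  (forall i, 0 <= p 0 i) -> (forall i, 0 <= u 0 i <= 1) ->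
  \sum_(i < n) u 0 i <= Gamma ->
  \sum_(i in S) p 0 i * u 0 i <=
    worst_ratio p Gamma S * \sum_(i in S) p 0 i.
Proof.
move=> p_ge0 u01 u_le.
have [p0|p_neq0] := eqVneq (\sum_(i in S) p 0 i) 0.
  rewrite p0 mulr0 -[leRHS]p0; apply: ler_sum => i _.
  by rewrite ler_piMr //; case/andP: (u01 i).
by rewrite /worst_ratio divfK //; exact: knapsack_le.
Qed.

Lemma worst_ratio_ge0 (R : realType) (n : nat) (p : 'rV[R]_n)
    (S : {set 'I_n}) (Gamma : R) :
  (forall i, 0 <= p 0 i) -> 0 <= Gamma -> 0 <= worst_ratio p Gamma S.
Proof.
move=> p_ge0 Gamma_ge0; apply: divr_ge0; last exact: sumr_ge0.
(* the zero perturbation has value 0 *)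
apply: le_trans (knapsack_le (u := 0) S p_ge0 _ _).
- by rewrite sumr_ge0 // => i _; rewrite mxE mulr0.
- by move=> i; rewrite mxE lexx ler01.
- by rewrite big1 // => i _; rewrite mxE.
Qed.

(** * Makespans *)

Lemma makespanE (R : realType) (n : nat) (x : allocation n) (d : 'rV[R]_n)
    (S := [set i | x i]%SET) :
  makespan x d = Num.max (\sum_(i in S) d 0 i) (\sum_(i in ~: S) d 0 i).
Proof.
rewrite /makespan; congr Num.max; rewrite [RHS]big_mkcond;
  apply: eq_bigr => i _; rewrite !inE; case: (x i);
  by rewrite ?subrr ?subr0 ?mul1r ?mul0r.
Qed.

Lemma makespanZ (R : realType) (n : nat) (x : allocation n) (c : R)
    (d : 'rV[R]_n) : 0 <= c -> makespan x (c *: d) = c * makespan x d.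
Proof.
move=> c_ge0; rewrite !makespanE maxr_pMr //; congr Num.max; rewrite mulr_sumr;
  by apply: eq_bigr => i _; rewrite mxE.
Qed.

Lemma makespan_gt0 (R : realType) (n : nat) (x : allocation n)
    (d : 'rV[R]_n) : (0 < n)%N -> (forall i, 0 < d 0 i) -> 0 < makespan x d.
Proof.
move=> n_gt0 d_gt0; pose i0 := Ordinal n_gt0; rewrite makespanE.
set S := [set i | x i]%SET.
have load_gt0 (A : {set 'I_n}) : i0 \in A -> 0 < \sum_(i in A) d 0 i.
  move=> Ai0; rewrite (bigD1 i0) //= ltr_wpDr // sumr_ge0 // => i _.
  exact: ltW.
rewrite lt_max; have [/load_gt0->//|notS] := boolP (i0 \in S).
by rewrite [X in _ || X]load_gt0 ?orbT // inE.
Qed.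

Lemma min_alloc_le (R : realType) (n : nat) (f : allocation n -> R)
    (x : allocation n) : min_alloc f <= f x.
Proof. by rewrite /min_alloc; case: arg_minP => // y _; apply. Qed.

(** * Worst cases over the budgeted set *)

(** The perturbation adds to each machine at most the fraction [alpha] times
its ratio of its nominal load; the larger ratio serves for both machines, so
the common factor comes out of the maximum of the two loads. *)
Lemma makespan_le (R : realType) (n : nat) (alpha Gamma : R)
    (d0 dbar d : 'rV[R]_n) (x : allocation n) (S := [set i | x i]%SET) :
  (forall i, 0 <= d0 0 i) -> 0 <= alpha ->
  (forall i, dbar 0 i = alpha * d0 0 i) -> 0 <= Gamma ->
  budgeted_set d0 dbar Gamma d ->
  makespan x d <= makespan x d0
    * (1 + alpha * Num.max (worst_ratio d0 Gamma S)
                           (worst_ratio d0 Gamma (~: S))).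
Proof.
move=> d0_ge0 alpha_ge0 dbarE Gamma_ge0 [u [dE u01 u_le]].
set w := Num.max _ _.
have load_le (A : {set 'I_n}) : worst_ratio d0 Gamma A <= w ->
    \sum_(i in A) d 0 i <= (\sum_(i in A) d0 0 i) * (1 + alpha * w).
  move=> ratio_le.
  have -> : \sum_(i in A) d 0 i =
      \sum_(i in A) d0 0 i + alpha * \sum_(i in A) d0 0 i * u 0 i.
    rewrite mulr_sumr -big_split; apply: eq_bigr => i _ /=.
    by rewrite dE dbarE mulrA.
  rewrite mulrDr mulr1 lerD2l mulrCA ler_wpM2l // mulrC.
  apply: le_trans (perturbation_le A d0_ge0 u01 u_le) _.
  by rewrite ler_wpM2r // sumr_ge0.
have factor_ge0 : 0 <= 1 + alpha * w.
  by rewrite addr_ge0 // mulr_ge0 // le_max worst_ratio_ge0.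
rewrite !makespanE -/S maxr_pMl // ge_max !le_max.
rewrite load_le ?le_max ?lexx //= [X in _ || X]load_le ?orbT //.
by rewrite le_max lexx orbT.
Qed.

(** A constant perturbation scales all durations by a common factor; when that
factor is positive, the optimal allocations remain those of the nominal problem.
[Gamma / n] is the largest constant that the budget affords. *)
Lemma even_budget (R : realType) (n : nat) (alpha Gamma : R)
    (d0 dbar : 'rV[R]_n) :
  (0 < n)%N -> (forall i, dbar 0 i = alpha * d0 0 i) ->
  0 <= Gamma <= n%:R ->
  budgeted_set d0 dbar Gamma ((1 + alpha * (Gamma / n%:R)) *: d0).
Proof.
move=> n_gt0 dbarE /andP[Gamma_ge0 Gamma_le].
have nR_gt0 : 0 < n%:R :> R by rewrite ltr0n.
exists (const_mx (Gamma / n%:R)); split => [i|i|].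
- by rewrite !mxE dbarE mulrDl mul1r mulrAC.
- by rewrite mxE divr_ge0 ?ler0n //= ler_pdivrMr // mul1r.
- under eq_bigr do rewrite mxE.
  by rewrite sumr_const card_ord -[X in X <= _]mulr_natr divfK ?gt_eqF.
Qed.

Theorem theorem1 (R : realType) (n : nat) (a_lo a_hi alpha Gamma : R)
    (d0 dbar : 'rV[R]_n) (xt : allocation n) (I : {set 'I_n}) :
  (2 <= n)%N ->
  0 < a_lo -> a_lo <= a_hi ->
  (forall i, a_lo <= d0 0 i <= a_hi) ->
  0 < alpha ->
  (forall i, dbar 0 i = alpha * d0 0 i) ->
  0 <= Gamma <= n%:R ->
  (forall x : allocation n, makespan xt d0 <= makespan x d0) ->
  I = [set i | xt i]%SET ->
  let U := budgeted_set d0 dbar Gamma in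
  SA U / PH U <=
    n%:R / (n%:R + Gamma * alpha)
    * (1 + alpha * Num.max (worst_ratio d0 Gamma I)
                           (worst_ratio d0 Gamma (finset.setC I))).
Proof.
move=> n_ge2 a_gt0 _ d0_bnd alpha_gt0 dbarE Gamma_bnd xt_min IE.
set U := budgeted_set d0 dbar Gamma; cbv zeta.
have n_gt0 : (0 < n)%N by exact: ltnW.
have nR_gt0 : 0 < n%:R :> R by rewrite ltr0n.
have d0_gt0 i : 0 < d0 0 i.
  by have /andP[+ _] := d0_bnd i; exact: lt_le_trans.
have d0_ge0 i : 0 <= d0 0 i by exact: ltW.
have Gamma_ge0 : 0 <= Gamma by case/andP: Gamma_bnd.
set w := Num.max _ _; set M := makespan xt d0.
have M_gt0 : 0 < M by exact: makespan_gt0.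
have Ubound d : U d -> makespan xt d <= M * (1 + alpha * w).
  by move=> Ud; rewrite /w IE; exact: (makespan_le (dbar := dbar) _ _ (ltW _)).
have c_gt0 : 0 < 1 + alpha * (Gamma / n%:R).
  by rewrite ltr_wpDr // mulr_ge0 ?(ltW alpha_gt0) // divr_ge0 ?ler0n.
set c := 1 + _ in c_gt0.
have Uc : U (c *: d0) by exact: even_budget.
have SA_le : SA U <= M * (1 + alpha * w).
  apply: le_trans (min_alloc_le _ xt) _.
  apply: ge_sup; first by exists (makespan xt (c *: d0)), (c *: d0).
  by move=> _ [d Ud <-]; exact: Ubound.
(* scaling by [c] preserves the optimality of [xt] *)
have PH_ge : M * c <= PH U.
  apply: (@le_trans _ _ (min_alloc (fun x => makespan x (c *: d0)))).
    rewrite /min_alloc; case: arg_minP => // y _ _.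
    by rewrite makespanZ ?(ltW c_gt0) // mulrC ler_wpM2l ?(ltW c_gt0).
  apply: ub_le_sup; last by exists (c *: d0).
  exists (M * (1 + alpha * w)) => _ [d Ud <-].
  by apply: le_trans (Ubound d Ud); exact: (min_alloc_le _ xt).
have PH_gt0 : 0 < PH U by apply: lt_le_trans PH_ge; rewrite mulr_gt0.
have factor_ge0 : 0 <= 1 + alpha * w.
  by rewrite addr_ge0 // mulr_ge0 ?(ltW alpha_gt0) // le_max worst_ratio_ge0.
have cE : c = (n%:R + Gamma * alpha) / n%:R.
  by rewrite mulrDl divff ?gt_eqF // (mulrC Gamma) -mulrA.
rewrite -[n%:R / _]invf_div -cE ler_pdivrMr // mulrAC.
by apply: le_trans SA_le _; rewrite ler_wpM2r // mulrC ler_pdivlMr.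
Qed.
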